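(* Let $C$ be a constant. The following two statements are equivalent: (i) there exists an irrational real $\alpha$ with $M(2^k\alpha)\leq C$ for all integers $k\geq 0$; (ii) for every integer $K\geq 0$ there exists an irrational real $\alpha_K$ such that $M(2^k\alpha_K)\leq C$ for all integers $0\leq k\leq K$.
   Context: For an irrational real $x$ with simple continued fraction expansion $x=[a_0;a_1,a_2,\ldots]$, write $a_n(x)$ for its $n$-th partial quotient and $M(x)=\sup_{n\geq 1}a_n(x)$ (which is $\infty$ if the partial quotients are unbounded). *)

(* Defs.v *)
From mathcomp Require Import all_boot all_order all_algebra.
From mathcomp Require Import mathcomp_extra boolp classical_sets.
From mathcomp Require Import reals ereal.

Set Implicit Arguments.
Unset Strict Implicit.
Unset Printing Implicit Defensive.

Import Order.TTheory GRing.Theory Num.Theory.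

Local Open Scope classical_set_scope.
Local Open Scope ring_scope.

(* The n-th complete quotient x_n: x_0 = x, x_(n+1) = 1 / (x_n - floor x_n).
   For irrational x every x_n is irrational, so the denominator never
   vanishes; for rational x the values are eventually junk. *)
Fixpoint complete_quotient (R : realType) (x : R) (n : nat) : R :=
  if n is m.+1 then
    (complete_quotient x m - (Num.floor (complete_quotient x m))%:~R)^-1
  else x.

Definition partial_quotient (R : realType) (x : R) (n : nat) : int :=
  Num.floor (complete_quotient x n).

(* The supremum starts at n = 1, so the integer part a_0 is not counted. *)
Definition max_partial_quotient (R : realType) (x : R) : \bar R :=
  ereal_sup [set ((partial_quotient x n)%:~R)%:E | n in [set n | (1 <= n)%N]].

(* Main.v *)
Require Import Defs.
From mathcomp Require Import all_boot all_order all_algebra.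
From mathcomp Require Import mathcomp_extra boolp classical_sets.
From mathcomp Require Import reals ereal.
From mathcomp Require Import ring lra.

Import Order.TTheory GRing.Theory Num.Theory.

Local Open Scope classical_set_scope.
Local Open Scope ring_scope.

(** The set of irrationals whose partial quotients are all at most [C] is
    closed: on it the fractional part keeps a distance [(C + 2)^-1] from the
    integers, so there the floor is locally constant and the Gauss map
    [x |-> (x - floor x)^-1] is locally Lipschitz. Hence every complete quotient
    of a limit point is again a limit point, in particular is not an integer
    (so the limit is irrational) and inherits the bound on its floor.
    Shifting by integers changes no [a_n] with [n >= 1], so the witnesses
    [alphaK] may be taken in [0, 1]; any cluster point of them works. *)

Section ContinuedFractions.
Set Implicit Arguments.
Unset Strict Implicit.
Context {R : realType}.
Implicit Types (x y C : R) (n k : nat) (m : int).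

Lemma rational_intr m : rational (m%:~R : R).
Proof. by exists m%:~R => //; rewrite ratr_int. Qed.

Lemma rationalD x y : rational x -> rational y -> rational (x + y).
Proof. by move=> [p _ <-] [q _ <-]; exists (p + q) => //; rewrite rmorphD. Qed.

Lemma rationalM x y : rational x -> rational y -> rational (x * y).
Proof. by move=> [p _ <-] [q _ <-]; exists (p * q) => //; rewrite rmorphM. Qed.

Lemma rationalV x : rational x -> rational x^-1.
Proof. by move=> [p _ <-]; exists p^-1 => //; rewrite fmorphV. Qed.

Lemma irrationalDz x m : irrational x -> irrational (x + m%:~R).
Proof.
move=> irrx ratx; apply: irrx.
rewrite -(addrK (m%:~R) x) -mulrNz.
by apply: rationalD => //; exact: rational_intr.
Qed.

Lemma irrational_frac_inv x :
  irrational x -> irrational (x - (Num.floor x)%:~R)^-1.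
Proof.
move=> irrx /rationalV; rewrite invrK -mulrNz.
exact: irrationalDz.
Qed.

Lemma complete_quotientSr x n :
  complete_quotient x n.+1 =
  complete_quotient (x - (Num.floor x)%:~R)^-1 n.
Proof. by elim: n => //= n <-. Qed.

Lemma complete_quotientDz x m n :
  complete_quotient (x + m%:~R) n.+1 = complete_quotient x n.+1.
Proof.
rewrite !complete_quotientSr; congr complete_quotient.
by rewrite floorDrz ?intr_int// intrKfloor intrD opprD addrACA subrr addr0.
Qed.

(* Euclid's algorithm: the denominators of the complete quotients decrease. *)
Lemma rational_complete_quotient_int x :
  rational x -> exists n, complete_quotient x n \is a Num.int.
Proof.
move=> /rationalP[p [q ->]].
elim/ltn_ind: q p => -[_ p|q IH p].
  (* Denominator 0 gives the value 0, since [0^-1 = 0]. *)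
  by exists 0%N; rewrite /= invr0 mulr0 int_num0.
have q0 : (q.+1%:R : R) != 0 by rewrite pnatr_eq0.
have r0 : 0 <= (p %% q.+1)%Z by rewrite modz_ge0.
have rq : (p %% q.+1)%Z < q.+1 by rewrite ltz_pmod.
have pE : (p%:~R / q.+1%:R : R) =
    (p %/ q.+1)%Z%:~R + (p %% q.+1)%Z%:~R / q.+1%:R.
  rewrite {1}(divz_eq p q.+1) intrD intrM mulrDl -mulrA.
  by rewrite -[X in _ * (X / _)]/(q.+1%:R) mulfV// mulr1.
case: (p %% q.+1)%Z r0 rq pE => // -[_ _|r _ rq] pE.
  by exists 0%N; rewrite /= pE mul0r addr0 intr_int.
(* The Gauss map inverts the fractional part [r.+1 / q.+1], leaving the smaller denominator
   [r.+1]. *)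
have [n nint] := IH r.+1 rq q.+1.
exists n.+1; rewrite pE addrC complete_quotientDz.
rewrite complete_quotientSr (_ : Num.floor _ = 0) ?subr0 ?invf_div//.
apply: floor_def; rewrite add0r divr_ge0//= ltr_pdivrMr ?ltr0n// mul1r.
by rewrite ltr_nat.
Qed.

Definition bounded_cf C x :=
  irrational x /\ forall n, (partial_quotient x n.+1)%:~R <= C.

Lemma max_partial_quotient_le C x :
  (max_partial_quotient x <= C%:E)%E <->
  forall n, (partial_quotient x n.+1)%:~R <= C.
Proof.
split=> [supC n|aC].
  by rewrite -lee_fin; apply: le_trans supC; apply: ereal_sup_ubound; exists n.+1.
by apply: ge_ereal_sup => _ [[//|n] _ <-]; rewrite lee_fin.
Qed.

Lemma bounded_cfDz C x m : bounded_cf C x -> bounded_cf C (x + m%:~R).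
Proof.
move=> [irrx xC]; split=> [|n]; first exact: irrationalDz.
by rewrite /partial_quotient complete_quotientDz; exact: xC.
Qed.

Lemma bounded_cf_frac_inv C x :
  bounded_cf C x -> bounded_cf C (x - (Num.floor x)%:~R)^-1.
Proof.
move=> [irrx xC]; split=> [|n]; first exact: irrational_frac_inv.
by rewrite /partial_quotient -complete_quotientSr; exact: xC.
Qed.

Lemma irrational_frac_gt0 x : irrational x -> 0 < x - (Num.floor x)%:~R.
Proof.
move=> irrx; rewrite lt_def subr_ge0 floor_le andbT subr_eq0.
by apply/eqP => xE; apply: irrx; rewrite xE; exact: rational_intr.
Qed.

(** With [f] the fractional part, [a_1] is the floor of [f^-1]: at least 1 because [f < 1], and at
    most [C], so [f^-1 < C + 1]. *)
Lemma bounded_cf_frac_lower C x : bounded_cf C x ->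
  0 < C /\ 1 < (C + 1) * (x - (Num.floor x)%:~R).
Proof.
move=> [irrx /(_ 0%N)]; rewrite /partial_quotient /=.
have := irrational_frac_gt0 irrx.
have := floorD1_gt x; rewrite intrD.
move: (x - _) (subrK (Num.floor x)%:~R x) => f fE.
rewrite -{1}fE addrC ltrD2l => f1 f0 aC.
have C1 : 1 <= C.
  apply: le_trans aC; rewrite -[1]/(1%:~R) ler_int -gtz0_ge1 floor_gt0.
  by rewrite invf_ge1// ltW.
split; first exact: lt_le_trans C1.
rewrite -ltr_pdivrMr// div1r; apply: lt_le_trans (floorD1_gt _) _.
by rewrite intrD lerD2r.
Qed.

(** The lower bound weakens [1 < (C + 1) * f]. For the upper one, the same estimate is applied to
    [f^-1]: its floor is at least 1, so [1 < (C + 1) * (f^-1 - 1)], that is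
    [f < (C + 1) / (C + 2)]. *)
Lemma bounded_cf_frac_itv C x : bounded_cf C x ->
  (C + 2)^-1 <= x - (Num.floor x)%:~R <= 1 - (C + 2)^-1.
Proof.
move=> xC; have [C0 lo] := bounded_cf_frac_lower xC.
have [_ ] := bounded_cf_frac_lower (bounded_cf_frac_inv xC).
have := irrational_frac_gt0 xC.1.
have := floorD1_gt x; rewrite intrD.
move: lo; move: (x - _) (subrK (Num.floor x)%:~R x) => f fE.
move=> lo; rewrite -{1}fE addrC ltrD2l => f1 f0.
have a1 : 1 <= (Num.floor f^-1)%:~R :> R.
  by rewrite -[1]/(1%:~R) ler_int -gtz0_ge1 floor_gt0 invf_ge1// ltW.
move=> lo2.
have {lo2 a1} : 1 < (C + 1) * (f^-1 - 1).
  by apply: lt_le_trans lo2 _; rewrite ler_pM2l ?lerD2l ?lerN2//; lra.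
rewrite mulrBr mulr1 ltrBrDr ltr_pdivlMr// => hi.
have C2 : 0 < C + 2 by lra.
have -> : 1 - (C + 2)^-1 = (C + 1) / (C + 2) by field; lra.
apply/andP; split; last by rewrite ler_pdivlMr//; lra.
by rewrite -div1r ler_pdivrMr//; lra.
Qed.

Definition adherent (A : set R) x :=
  forall e, 0 < e -> exists2 y, A y & `|x - y| < e.

Lemma floor_near_bounded_cf C x y : bounded_cf C y ->
  `|x - y| < (C + 2)^-1 -> Num.floor x = Num.floor y.
Proof.
move=> /bounded_cf_frac_itv/andP[lo hi]; rewrite ltr_distl => /andP[xl xu].
by apply: floor_def; rewrite intrD; apply/andP; split; lra.
Qed.

(** [bounded_cf] says nothing about the floor of its argument, so the bound on [a_1] of the
    approximants would be lost under the Gauss map; the target set carries it along. *)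
Lemma adherent_bounded_cf_frac C x : adherent (bounded_cf C) x ->
  (x \isn't a Num.int) /\
  adherent [set y | bounded_cf C y /\ (Num.floor y)%:~R <= C]
    (x - (Num.floor x)%:~R)^-1.
Proof.
move=> xC.
have C0 : 0 < C by have [y /bounded_cf_frac_lower[]] := xC 1 ltr01.
pose d : R := (C + 2)^-1.
have d0 : 0 < d by rewrite invr_gt0; lra.
have frac_lo y : bounded_cf C y -> `|x - y| < d / 2 ->
    [/\ Num.floor x = Num.floor y, d <= y - (Num.floor y)%:~R &
        d / 2 < x - (Num.floor x)%:~R].
  move=> yC xy; have fE : Num.floor x = Num.floor y.
    by apply: floor_near_bounded_cf yC _; apply: lt_trans xy _; rewrite -/d; lra.
  have /andP[lo _] := bounded_cf_frac_itv yC.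
  split=> //; rewrite fE; move: xy; rewrite ltr_distl => /andP[? ?].
  rewrite -/d in lo; lra.
split.
  have [|y yC /(frac_lo _ yC)[_ _]] := xC (d / 2); first by lra.
  by apply: contraTN; rewrite intrEfloor => /eqP ->; rewrite subrr -leNgt; lra.
move=> e e0.
(* The first bound makes the floors agree and gives [d / 2 < f] and [d <= g] for the fractional
   parts of [x] and [y]. The second absorbs the denominator of [f^-1 - g^-1 = (g - f) / (f * g)]. *)
pose e' := Num.min (d / 2) (e * (d / 2 * d)).
have [|y yC] := xC e'.
  by rewrite lt_min !mulr_gt0 ?invr_gt0//; lra.
rewrite lt_min => /andP[xy1 xy2].
have [fE ylo xlo] := frac_lo y yC xy1.
exists (y - (Num.floor y)%:~R)^-1.
  by split; [exact: bounded_cf_frac_inv | exact: (yC.2 0%N)].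
move: xy2 ylo xlo; rewrite -fE.
have -> : x - y = (x - (Num.floor x)%:~R) - (y - (Num.floor x)%:~R) by ring.
move: (x - _) (y - _) => f g fg glo flo.
have f0 : 0 < f by lra.
have g0 : 0 < g by lra.
have -> : f^-1 - g^-1 = (g - f) / (f * g) by field; rewrite !gt_eqF.
rewrite normrM normfV (gtr0_norm (mulr_gt0 f0 g0)) distrC.
rewrite ltr_pdivrMr ?mulr_gt0//; apply: lt_le_trans fg _.
by rewrite ler_pM2l// ler_pM//; lra.
Qed.

Lemma adherent_bounded_cf C x : adherent (bounded_cf C) x -> bounded_cf C x.
Proof.
move=> xC.
have cqC n : adherent (bounded_cf C) (complete_quotient x n).
  elim: n => //= n /adherent_bounded_cf_frac[_ IH] e /IH[y [yC _] ye].
  by exists y.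
split=> [/rational_complete_quotient_int[n]|n].
  by apply/negP; have [] := adherent_bounded_cf_frac (cqC n).
have [_ /=] := adherent_bounded_cf_frac (cqC n).
rewrite /partial_quotient -/(complete_quotient x n.+1) => near.
(* Any approximant shows [0 < C], so the radius [(C + 2)^-1] is positive. *)
have [y0 [y0C _] _] := near 1 ltr01.
have d0 : 0 < (C + 2)^-1.
  by have [C0 _] := bounded_cf_frac_lower y0C; rewrite invr_gt0; lra.
by have [y [yC fC] /(floor_near_bounded_cf yC) ->] := near _ d0.
Qed.

(** The cluster point is the limit superior of [u], obtained as the supremum of the [t] that [u]
    reaches or exceeds infinitely often. *)
Lemma cluster_point_itv01 (u : nat -> R) :
  (forall n, 0 <= u n <= 1) ->
  exists a, forall e, 0 < e -> forall N, exists2 n, (N <= n)%N & `|a - u n| < e.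
Proof.
move=> u01.
pose S := [set t | forall N, exists2 n, (N <= n)%N & t <= u n].
have supS : has_sup S.
  split; first by exists 0 => N; exists N => //; have /andP[] := u01 N.
  exists 1 => t /(_ 0%N)[n _ tu]; apply: le_trans tu _.
  by have /andP[] := u01 n.
exists (sup S) => e e0 N.
(* Otherwise [sup S + e] would itself lie in [S]. *)
have [N0 ltN0] : exists N0, forall n, (N0 <= n)%N -> u n < sup S + e.
  apply: contrapT => noN0.
  have : S (sup S + e).
    move=> N0; apply: contrapT => H; apply: noN0; exists N0 => n N0n.
    by rewrite ltNge; apply/negP => le_un; apply: H; exists n.
  by move/(sup_upper_bound supS); lra.
have [t St tlt] := sup_adherent e0 supS.
have [n] := St (maxn N N0); rewrite geq_max => /andP[Nn N0n] tu.
exists n => //; rewrite ltr_distlC.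
by apply/andP; split; [exact: lt_le_trans tlt tu | exact: ltN0].
Qed.

End ContinuedFractions.

Theorem theorem3p5 (R : realType) (C : R) :
  (exists alpha : R, @irrational R alpha /\
     forall k : nat, (max_partial_quotient (2 ^+ k * alpha) <= C%:E)%E)
  <->
  (forall K : nat, exists alphaK : R, @irrational R alphaK /\
     forall k : nat, (k <= K)%N ->
       (max_partial_quotient (2 ^+ k * alphaK) <= C%:E)%E).
Proof.
split=> [[alpha [irr bnd]] K|finite]; first by exists alpha.
have /choice[u uP] : forall K, exists t : R, 0 <= t <= 1 /\
    forall k, (k <= K)%N -> bounded_cf C (2 ^+ k * t).
  move=> K; have [a [irra aC]] := finite K.
  (* Dropping the integer part changes each [2 ^+ k * a] by an integer only. *)
  exists (a - (Num.floor a)%:~R); split.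
    have := floor_le a; have := floorD1_gt a; rewrite intrD => ? ?.
    by apply/andP; split; lra.
  move=> k kK.
  have -> : 2 ^+ k * (a - (Num.floor a)%:~R) =
      2 ^+ k * a + (- (2 ^+ k * Num.floor a))%:~R.
    by rewrite mulrBr mulrNz intrM rmorphXn.
  apply: bounded_cfDz; split; last exact/max_partial_quotient_le/aC.
  move=> rat2a; apply: irra.
  rewrite -(mulKf (_ : 2 ^+ k != 0) a) ?expf_neq0 ?pnatr_eq0//.
  apply: rationalM rat2a; apply: rationalV.
  by rewrite -(rmorphXn intr k 2); exact: rational_intr.
have [a aP] := cluster_point_itv01 (fun K => (uP K).1).
have aC k : bounded_cf C (2 ^+ k * a).
  apply: adherent_bounded_cf => e e0.
  have p0 : 0 < 2 ^+ k :> R by rewrite exprn_gt0.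
  (* Clustering gives an index [K >= k], for which [2 ^+ k * u K] obeys the bound; the radius
     [e / 2 ^+ k] offsets the scaling. *)
  have [|K kK aK] := aP (e / 2 ^+ k) _ k; first by rewrite divr_gt0.
  exists (2 ^+ k * u K); first exact: (uP K).2.
  by rewrite -mulrBr normrM gtr0_norm// mulrC -ltr_pdivlMr.
exists a; split=> [|k]; last exact/max_partial_quotient_le/(aC k).2.
by have [] := aC 0%N; rewrite expr0 mul1r.
Qed.
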